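(* Let $\mathcal{E}$ be any countable directed graph without sinks. Then the path groupoid (graph groupoid) $G$ of $\mathcal{E}$ is amenable as a locally compact groupoid.
   Context: Graph conventions. $\mathcal{E}$ is a directed graph with countable vertex set $V$ and countable edge set $E$; $s(e),r(e)$ are the initial and terminal vertices of an edge $e$. No sinks: every vertex is the source of at least one edge. $V_\infty$ is the set of vertices emitting infinitely many edges. A finite path is $\alpha=e_1\cdots e_k$ with $r(e_i)=s(e_{i+1})$, length $l(\alpha)=k$, $s(\alpha)=s(e_1)$, $r(\alpha)=r(e_k)$; each vertex $v$ is a finite path of length $0$ with $s(v)=r(v)=v$, and $s(\mu)\mu=\mu=\mu r(\mu)$. $Y$ is the set of finite paths, $Z$ the set of infinite paths $z_1z_2\cdots$, and $Y_\infty=\{y\in Y: r(y)\in V_\infty\}$. Path groupoid. $X=Y_\infty\cup Z$. $G$ is the set of triples $(\alpha\gamma,\,l(\alpha)-l(\beta),\,\beta\gamma)$ with $\alpha,\beta\in Y$, $\gamma\in X$, $r(\alpha)=r(\beta)=s(\gamma)$; multiplication $(x,m,y)(y,n,w)=(x,m+n,w)$, inverse $(x,m,y)^{-1}=(y,-m,x)$, unit space identified with $X$ via $x\leftrightarrow(x,0,x)$. For $\alpha,\beta\in Y$ with $r(\alpha)=r(\beta)$ let $A'_{\alpha,\beta}=\{(\alpha\gamma,l(\alpha)-l(\beta),\beta\gamma)\in G\}$. A basis for the topology of $G$ is given by the sets $A'_{\alpha,\beta}\setminus\bigcup_{i=1}^nA'_{\alpha\mu_i,\beta\mu_i}$ ($n\ge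 0$, $\mu_i\in Y$ with $s(\mu_i)=r(\alpha)$). $G$ is an r-discrete (étale) locally compact Hausdorff groupoid with counting measures as left Haar system. Amenability is (topological) amenability of locally compact groupoids in the sense of Renault: there is a net $(f_i)$ in $C_c(G)$ such that the functions $u\mapsto\sum_{r(g)=u}|f_i(g)|^2$ are uniformly bounded in $i$ and $u$, and $f_i*f_i^*\to 1$ uniformly on compact subsets of $G$ (convolution with respect to counting measures, $f^*(g)=\overline{f(g^{-1})}$). *)

(* Defs.v *)
From HB Require Import structures.
From mathcomp Require Import all_boot all_order all_algebra.
From mathcomp Require Import complex ring.
From mathcomp Require Import all_classical all_reals topology normedtype.

Set Implicit Arguments.
Unset Strict Implicit.
Unset Printing Implicit Defensive.

Import Order.TTheory GRing.Theory Num.Theory.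
Import numFieldNormedType.Exports.

Local Open Scope classical_set_scope.
Local Open Scope ring_scope.
Local Open Scope complex_scope.

(* The composite [gmul e] of [g] and [h] requires a proof [e] that [g] and [h]
   are composable. *)
Record groupoid := Groupoid {
  arrow :> topologicalType ;
  gunit : Type ;
  grng : arrow -> gunit ;
  gsrc : arrow -> gunit ;
  gid : gunit -> arrow ;
  ginv : arrow -> arrow ;
  gmul : forall g h : arrow, gsrc g = grng h -> arrow ;
  grng_id : forall u, grng (gid u) = u ;
  gsrc_id : forall u, gsrc (gid u) = u ;
  grng_inv : forall g, grng (ginv g) = gsrc g ;
  gsrc_inv : forall g, gsrc (ginv g) = grng g ;
  grng_mul : forall g h (e : gsrc g = grng h), grng (gmul e) = grng g ;
  gsrc_mul : forall g h (e : gsrc g = grng h), gsrc (gmul e) = gsrc h ;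
  gmulA : forall g h k (egh : gsrc g = grng h) (ehk : gsrc h = grng k)
    (e1 : gsrc (gmul egh) = grng k) (e2 : gsrc g = grng (gmul ehk)),
    gmul e1 = gmul e2 ;
  gmul1g : forall u g (e : gsrc (gid u) = grng g), gmul e = g ;
  gmulg1 : forall g u (e : gsrc g = grng (gid u)), gmul e = g ;
  gmulVg : forall g (e : gsrc (ginv g) = grng g), gmul e = gid (gsrc g) ;
  gmulgV : forall g (e : gsrc g = grng (ginv g)), gmul e = gid (grng g)
}.

Arguments gmul {g0 g h} : rename.

Section Amenability.
Variables (R : realType) (G : groupoid).
Implicit Types f : G -> R[i].

(* [^o] selects the topology of the norm on R[i]. *)
Definition Cc : set (G -> R[i]) :=
  [set f : G -> R[i] | continuous (f : G -> R[i]^o) /\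
           compact (closure [set g | f g != 0])].

Definition factorizations (g : G) : set (G * G) :=
  [set p | exists e : gsrc p.1 = grng p.2, gmul e = g].

(* Convolution with respect to the counting measures.  In an etale groupoid
   the fibres of [grng] are closed and discrete, so for functions in [Cc] this
   sum and the one in [fibre_norm2] are finite; see [Cc_fibre_finite] for the
   path groupoid.  (The big operator returns 0 on an infinite support.) *)
Definition convolution f1 f2 : G -> R[i] := fun g =>
  \sum_(p \in factorizations g) (f1 p.1 * f2 p.2).

Definition involution f : G -> R[i] := fun g => ((f (ginv g))^*)%R.

Definition fibre_norm2 f (u : gunit G) : R[i] :=
  \sum_(g \in [set g : G | grng g = u]) (`|f g| ^+ 2).

End Amenability.

Definition directed (I : Type) (le : I -> I -> Prop) : Prop :=
  [/\ inhabited I,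
      (forall i, le i i),
      (forall i j k, le i j -> le j k -> le i k)
    & (forall i j, exists2 k, le i k & le j k)].

Definition amenable (R : realType) (G : groupoid) : Prop :=
  exists (I : Type) (le : I -> I -> Prop) (f : I -> G -> R[i]),
  [/\ directed le,
      (forall i, Cc (f i)),
      (exists M : R, forall i u, fibre_norm2 (f i) u <= M%:C)
    & (forall K : set G, compact K -> forall eps : R, 0 < eps ->
        exists i0, forall i, le i0 i -> forall g, K g ->
          `|convolution (f i) (involution (f i)) g - 1| < eps%:C)].

Record digraph := Digraph {
  vertex : countType ;
  edge : countType ;
  esrc : edge -> vertex ;
  etgt : edge -> vertex
}.

Definition no_sinks (E : digraph) : Prop :=
  forall v : vertex E, exists e : edge E, esrc e = v.

Section Paths.
Variable E : digraph.

Definition infinite_emitter (v : vertex E) : Prop :=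
  infinite_set [set e : edge E | esrc e = v].

(* A word (v, e_1 ... e_k) stands for the path e_1 ... e_k with initial vertex
   v; (v, [::]) is the path v of length 0. *)
Definition word : Type := (vertex E * seq (edge E))%type.
HB.instance Definition _ := Countable.on word.

Definition wtgt (a : word) : vertex E := last a.1 (map (@etgt E) a.2).
Definition wlen (a : word) : nat := size a.2.

Fixpoint is_chain (v : vertex E) (es : seq (edge E)) : Prop :=
  if es is e :: es' then esrc e = v /\ is_chain (etgt e) es' else True.

Definition fpath : set word := [set a | is_chain a.1 a.2].

(* The concatenation of [a] and [m]; meaningful when [wtgt a = m.1]. *)
Definition wcat (a m : word) : word := (a.1, a.2 ++ m.2).

Inductive bword : Type := Fin of word | Inf of (nat -> edge E).
HB.instance Definition _ := gen_eqMixin bword.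
HB.instance Definition _ := gen_choiceMixin bword.

Definition boundary : set bword := [set x |
  match x with
  | Fin a => fpath a /\ infinite_emitter (wtgt a)
  | Inf z => forall n, etgt (z n) = esrc (z n.+1)
  end].

Definition bpath : Type := set_type boundary.
HB.instance Definition _ := Choice.on bpath.

Definition bwsrc (x : bword) : vertex E :=
  match x with Fin a => a.1 | Inf z => esrc (z 0%N) end.

(* Below the default value of [nth] provides the letters of [z] following
   those of [a]. *)
Definition bwcat (a : word) (x : bword) : bword :=
  match x with
  | Fin c => Fin (wcat a c)
  | Inf z => Inf (fun n => nth (z (n - wlen a)%N) a.2 n)
  end.

Definition triple : Type := (bpath * int * bpath)%type.

Definition cylinder (a b : word) : set triple := [set t |
  exists c : bpath,
    [/\ wtgt a = bwsrc (val c), wtgt b = bwsrc (val c),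
        val t.1.1 = bwcat a (val c), t.1.2 = (wlen a)%:Z - (wlen b)%:Z
      & val t.2 = bwcat b (val c)]].

Definition path_triple : set triple := [set t |
  exists a b, [/\ fpath a, fpath b & cylinder a b t]].

Definition path_arrow : Type := set_type path_triple.
HB.instance Definition _ := Choice.on path_arrow.

(* A'_{a,b} minus the finite union of the A'_{a m,b m}, for m in M. *)
Definition basic_set (a b : word) (M : set word) : set path_arrow :=
  [set g | cylinder a b (val g) /\
     forall m, M m -> ~ cylinder (wcat a m) (wcat b m) (val g)].

Definition path_basis : set (set path_arrow) := [set B |
  exists a b M,
    [/\ fpath a, fpath b, wtgt a = wtgt b,
        finite_set M /\ M `<=` [set m | fpath m /\ m.1 = wtgt a]
      & B = basic_set a b M]].

Definition path_open : set (set path_arrow) := [set U |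
  forall g, U g -> exists2 B, path_basis B & B g /\ B `<=` U].

Lemma is_chain_cat v es fs : is_chain v (es ++ fs) <->
  is_chain v es /\ is_chain (wtgt (v, es)) fs.
Proof.
elim: es v => [|e es IH] v /=; first by split=> [|[]].
by rewrite IH /wtgt /=; tauto.
Qed.

Lemma wtgt_cat a m : m.1 = wtgt a -> wtgt (wcat a m) = wtgt m.
Proof.
by move=> e; rewrite /wtgt /= map_cat last_cat e.
Qed.

Lemma fpath_cat a m : fpath a -> fpath m -> m.1 = wtgt a -> fpath (wcat a m).
Proof.
move=> pa pm e; apply/is_chain_cat; split=> //.
by change (is_chain (wtgt a) m.2); rewrite -e.
Qed.

Lemma bwsrc_cat a x : fpath a -> wtgt a = bwsrc x -> bwsrc (bwcat a x) = a.1.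
Proof.
case: x => [//|z]; case: a => v [|e es] /=; first by rewrite /wtgt => _ <-.
by case.
Qed.

Lemma bwcatA a m x : bwcat (wcat a m) x = bwcat a (bwcat m x).
Proof.
case: x => [c|z] /=; first by rewrite /wcat /= catA.
congr Inf; apply/funext => n; rewrite /wlen nth_cat size_cat subnDA.
by case: ltnP => h; [exact: set_nth_default | rewrite [RHS]nth_default].
Qed.

Lemma boundary_cat a x : fpath a -> boundary x -> wtgt a = bwsrc x ->
  boundary (bwcat a x).
Proof.
case: x => [c|z] /= pa.
  move=> [pc ic] e; split; first exact: fpath_cat.
  by rewrite wtgt_cat.
move=> zP e n.
case: a => v es in pa e *; rewrite /wtgt /wlen /fpath /= in pa e *.
elim: es v n pa e => [|f es IH] v n /=.
  by rewrite subn0 !nth_nil // => _ _; rewrite ?subn0.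
case=> _ pes e; case: n => [|n] /=; last by rewrite !subSS; exact: (IH (etgt f)).
case: es pes e {IH} => [|f' es] /= pes e; first by rewrite subnn.
by case: pes => ->.
Qed.

(* Two factorizations of the same boundary path. *)
Lemma bwcat_eq a b x y : bwcat a x = bwcat b y -> fpath b ->
  wtgt a = bwsrc x -> wtgt b = bwsrc y -> a.1 = b.1 ->
  (wlen a <= wlen b)%N ->
  exists m, [/\ m.1 = wtgt a, fpath m, b = wcat a m & x = bwcat m y].
Proof.
move=> exy pb ax bY e1 ab; exists (wtgt a, drop (wlen a) b.2).
have tk : take (wlen a) b.2 = a.2.
  case: x y exy ax bY => [c|z] [d|w] //=.
    move=> [_ h] _ _; have := congr1 (take (wlen a)) h.
    by rewrite take_size_cat // takel_cat.
  move=> [h] _ _; case: a b ab h {pb e1} => v [|e es] [v' fs] /=; first by rewrite take0.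
  rewrite /wlen /= => ab h; apply: (@eq_from_nth _ e); first by rewrite size_takel.
  move=> i; rewrite size_takel // => ilt; rewrite nth_take //.
  have := congr1 (@^~ i) h; rewrite /= => h'.
  rewrite (set_nth_default (w (i - size fs)%N)) ?(leq_trans ilt) // -h'.
  by apply: set_nth_default.
have bE : b = wcat a (wtgt a, drop (wlen a) b.2).
  by rewrite [LHS]surjective_pairing /wcat /= -{1}tk cat_take_drop e1.
split=> //.
  by move: pb; rewrite {1}bE => /is_chain_cat [].
move: exy; rewrite {1}bE bwcatA.
have : bwsrc x = wtgt a by [].
have : bwsrc (bwcat (wtgt a, drop (wlen a) b.2) y) = wtgt a.
  rewrite bwsrc_cat //.
    by move: pb; rewrite {1}bE => /is_chain_cat [].
  by rewrite -bY {2}bE wtgt_cat.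
move: (bwcat _ y) => y' sy sx.
case: x y' sx sy {ax bY tk} => [c|z] [d|w] //= sx sy.
  move=> [h]; congr Fin; rewrite [c]surjective_pairing [d]surjective_pairing sx sy.
  by congr pair; have := congr1 (drop (size a.2)) h; rewrite !drop_size_cat.
move=> [h]; congr Inf; apply/funext => n.
have := congr1 (@^~ (wlen a + n)%N) h; rewrite /= addKn.
by rewrite !nth_default // leq_addr.
Qed.

Lemma cylinder_rng a b t : fpath a -> cylinder a b t -> a.1 = bwsrc (val t.1.1).
Proof. by move=> pa [c [e1 _ -> _ _]]; rewrite bwsrc_cat. Qed.

Lemma cylinder_src a b t : fpath b -> cylinder a b t -> b.1 = bwsrc (val t.2).
Proof. by move=> pb [c [_ e1 _ _ ->]]; rewrite bwsrc_cat. Qed.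

Lemma bpath_cat a (c : bpath) : fpath a -> wtgt a = bwsrc (val c) ->
  {d : bpath | val d = bwcat a (val c)}.
Proof.
move=> pa e; have h : boundary (bwcat a (val c)).
  by apply: boundary_cat => //; exact: set_valP.
by exists (exist (fun x => x \in boundary) _ (mem_set h)).
Qed.

Lemma cylinder_cat a b m : wtgt a = wtgt b -> fpath m -> m.1 = wtgt a ->
  cylinder (wcat a m) (wcat b m) `<=` cylinder a b.
Proof.
move=> ab pm ma t [c [e1 e2 e3 e4 e5]].
have sm : wtgt m = bwsrc (val c) by rewrite -e1 wtgt_cat.
have [d dE] := bpath_cat pm sm.
exists d; rewrite dE -!bwcatA (bwsrc_cat pm sm) -ab; split => //.
by rewrite e4 /wlen /wcat /= !size_cat !PoszD opprD addrACA subrr addr0.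
Qed.

Lemma cylinder_meet a b a' b' t : fpath a -> fpath b -> fpath a' -> fpath b' ->
  cylinder a b t -> cylinder a' b' t -> (wlen a <= wlen a')%N ->
  exists m, [/\ m.1 = wtgt a, fpath m, a' = wcat a m & b' = wcat b m].
Proof.
move=> pa pb pa' pb' tab tab' le.
have sa : a.1 = a'.1 by rewrite (cylinder_rng pa tab) (cylinder_rng pa' tab').
have sb : b.1 = b'.1 by rewrite (cylinder_src pb tab) (cylinder_src pb' tab').
case: tab tab' => c [e1 e2 e3 e4 e5] [d [d1 d2 d3 d4 d5]].
have [m [m1 pm m2 m3]] := bwcat_eq (etrans (esym e3) d3) pa' e1 d1 sa le.
exists m; split=> //.
have len : (wlen a)%:Z + (wlen b')%:Z = (wlen a')%:Z + (wlen b)%:Z.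
  by apply/eqP; rewrite -subr_eq addrAC -e4 d4 subrK.
have {}len : wlen b' = (wlen b + wlen m)%N.
  have := len; rewrite m2 /wlen /wcat /= size_cat -!PoszD => -[h].
  by apply/eqP; rewrite -(eqn_add2l (size a.2)) h addnAC addnA.
have le' : (wlen b <= wlen b')%N by rewrite len leq_addr.
have [m' [m1' pm' m2' m3']] := bwcat_eq (etrans (esym e5) d5) pb' e2 d2 sb le'.
suff <- : m' = m by [].
have s : size m'.2 = size m.2.
  apply/eqP; have := len; rewrite m2' /wlen /wcat /= size_cat => /eqP.
  by rewrite eqn_add2l.
rewrite [m]surjective_pairing [m']surjective_pairing m1 m1' e1 e2; congr pair.
have := m3; rewrite m3'; case: (val d) => [q|z] /= [].
  by move=> _ /(congr1 (take (size m.2))); rewrite -{1}s !take_size_cat.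
move=> h; case: m s h {m1 pm m2 m3 len m3'} => v [|x es] /=.
  by move=> /size0nil.
move=> s h; apply: (@eq_from_nth _ x) => // i il.
have := congr1 (@^~ i) h => /=.
have il' : (i < size (x :: es))%N by rewrite /= -s.
rewrite (set_nth_default (z (i - wlen m')%N) x il) => ->.
exact: set_nth_default.
Qed.

Lemma basic_meet (a b a' b' : word) (M M' : set word) g :
  fpath a -> fpath b -> wtgt a = wtgt b ->
  finite_set M -> M `<=` [set m | fpath m /\ m.1 = wtgt a] ->
  fpath a' -> fpath b' -> wtgt a' = wtgt b' ->
  finite_set M' -> M' `<=` [set m | fpath m /\ m.1 = wtgt a'] ->
  basic_set a b M g -> basic_set a' b' M' g -> (wlen a <= wlen a')%N ->
  exists2 B, path_basis B & B g /\ B `<=` basic_set a b M `&` basic_set a' b' M'.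
Proof.
move=> pa pb ab fM sM pa' pb' ab' fM' sM' [ga gM] [ga' gM'] le.
have [n [n1 pn an bn]] := cylinder_meet pa pb pa' pb' ga ga' le.
have nn : wtgt a' = wtgt n by rewrite an wtgt_cat.
pose N := [set m | [/\ fpath m, m.1 = wtgt a' & M (wcat n m)]].
have catNE w m : wcat (wcat w n) m = wcat w (wcat n m) by rewrite /wcat /= catA.
exists (basic_set a' b' (M' `|` N)).
  exists a', b', (M' `|` N); split=> //; split.
    rewrite finite_setU; split=> //.
    apply: (@sub_finite_set _ _ ([set (wtgt a', drop (wlen n) m.2) | m in M])).
      move=> m [pm m1 Mm]; exists (wcat n m) => //=.
      by rewrite drop_size_cat // -m1 -surjective_pairing.
    exact: finite_image.
  by move=> m [/sM'//|[]].
split.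
  split=> // m [/gM'//|[pm m1 Mm]].
  by rewrite an bn !catNE; exact: gM.
move=> h [ha' hM]; split; last by split=> // m Mm; apply: hM; left.
have cn : cylinder (wcat a n) (wcat b n) `<=` cylinder a b by exact: cylinder_cat.
split; first by apply: cn; rewrite -an -bn.
move=> m Mm hm; have [pm m1] := sM _ Mm.
have m1' : m.1 = wtgt b by rewrite -ab.
have pam : fpath (wcat a m) by exact: fpath_cat.
have pbm : fpath (wcat b m) by exact: fpath_cat.
case: (leqP (wlen a') (wlen (wcat a m))) => lm.
  have [k [k1 pk ak bk]] := cylinder_meet pa' pb' pam pbm ha' hm lm.
  apply: (hM k); last by rewrite -ak -bk.
  right; split=> //; suff -> : wcat n k = m by [].
  rewrite [m]surjective_pairing [wcat n k]surjective_pairing; congr pair.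
    by rewrite m1 -n1.
  move: ak; rewrite an catNE => -[] /(congr1 (drop (size a.2))).
  by rewrite !drop_size_cat.
have [k [k1 pk ak bk]] := cylinder_meet pam pbm pa' pb' hm ha' (ltnW lm).
apply: (gM m Mm); move: ga'; rewrite ak bk.
by apply: cylinder_cat => //; rewrite !wtgt_cat.
Qed.

Lemma path_openT : path_open setT.
Proof.
move=> g _; have [a [b [pa pb gab]]] := set_valP g.
exists (basic_set a b set0); last by split=> //; split.
by exists a, b, set0; split=> //; case: gab => c [-> ->].
Qed.

Lemma path_openI : setI_closed path_open.
Proof.
move=> U V oU oV g [Ug Vg].
have [_ [a [b [M [pa pb ab [fM sM] ->]]]] [Bg BU]] := oU _ Ug.
have [_ [a' [b' [M' [pa' pb' ab' [fM' sM'] ->]]]] [Bg' BV]] := oV _ Vg.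
case: (leqP (wlen a) (wlen a')) => [le|/ltnW le].
  have [B bB [gB sB]] := basic_meet pa pb ab fM sM pa' pb' ab' fM' sM' Bg Bg' le.
  by exists B => //; split=> // h /sB [/BU ? /BV].
have [B bB [gB sB]] := basic_meet pa' pb' ab' fM' sM' pa pb ab fM sM Bg' Bg le.
by exists B => //; split=> // h /sB [/BV ? /BU].
Qed.

Lemma path_open_bigU (I : Type) (f : I -> set path_arrow) :
  (forall i, path_open (f i)) -> path_open (\bigcup_i f i).
Proof.
move=> of_ g [i _ fg]; have [B bB [gB sB]] := of_ i _ fg.
by exists B => //; split=> // h /sB; exists i.
Qed.

HB.instance Definition _ :=
  isOpenTopological.Build path_arrow path_openT path_openI path_open_bigU.

Lemma path_arrow_openE : @open path_arrow = path_open.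
Proof. by []. Qed.

Lemma path_triple_id (x : bpath) : path_triple (x, 0, x).
Proof.
pose v : word := (bwsrc (val x), [::]).
have vx : bwcat v (val x) = val x.
  rewrite /v; case: (val x) => [[w es]|z] //=.
  by congr Inf; apply/funext => n; rewrite nth_nil subn0.
by exists v, v; split=> //; exists x; split=> //=; rewrite ?vx ?subrr.
Qed.

Lemma path_triple_inv (t : triple) :
  path_triple t -> path_triple (t.2, - t.1.2, t.1.1).
Proof.
move=> [a [b [pa pb [c [? ? ? h ?]]]]]; exists b, a; split=> //.
by exists c; split=> //=; rewrite h opprB.
Qed.

Lemma path_triple_mul (s t : triple) : path_triple s -> path_triple t ->
  s.2 = t.1.1 -> path_triple (s.1.1, s.1.2 + t.1.2, t.2).
Proof.
move=> [a [b [pa pb [c [c1 c2 c3 c4 c5]]]]].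
move=> [a' [b' [pa' pb' [d [d1 d2 d3 d4 d5]]]]] st.
have E1 : bwcat b (val c) = bwcat a' (val d) by rewrite -c5 -d3 st.
have E2 : b.1 = a'.1 by rewrite -(bwsrc_cat pb c2) E1 bwsrc_cat.
case: (leqP (wlen b) (wlen a')) => [le|/ltnW le].
  have [m [m1 pm m2 m3]] := bwcat_eq E1 pa' c2 d1 E2 le.
  have ma : m.1 = wtgt a by rewrite m1 c1 c2.
  exists (wcat a m), b'; split=> //; first exact: fpath_cat.
  exists d; split=> //=.
  - by rewrite wtgt_cat // -d1 m2 wtgt_cat.
  - by rewrite bwcatA -m3.
  - rewrite c4 d4 m2 /wlen /= !size_cat !PoszD; ring.
have [m [m1 pm m2 m3]] := bwcat_eq (esym E1) pb d1 c2 (esym E2) le.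
have mb : m.1 = wtgt b' by rewrite m1 d1 d2.
exists a, (wcat b' m); split=> //; first exact: fpath_cat.
exists c; split=> //=.
- by rewrite wtgt_cat // -c2 m2 wtgt_cat.
- rewrite c4 d4 m2 /wlen /= !size_cat !PoszD; ring.
- by rewrite bwcatA -m3.
Qed.

Definition to_arrow (t : triple) (h : path_triple t) : path_arrow :=
  exist (fun t => t \in path_triple) t (mem_set h).

Definition parng (g : path_arrow) : bpath := (val g).1.1.
Definition pasrc (g : path_arrow) : bpath := (val g).2.

Definition paid (x : bpath) : path_arrow :=
  to_arrow (path_triple_id x).

Definition painv (g : path_arrow) : path_arrow :=
  to_arrow (path_triple_inv (set_valP g)).

Definition pamul (g h : path_arrow) (e : pasrc g = parng h) : path_arrow :=
  to_arrow (path_triple_mul (set_valP g) (set_valP h) e).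

Lemma pamulA g h k (egh : pasrc g = parng h) (ehk : pasrc h = parng k)
    (e1 : pasrc (pamul egh) = parng k) (e2 : pasrc g = parng (pamul ehk)) :
  pamul e1 = pamul e2.
Proof. by apply: val_inj => /=; rewrite addrA. Qed.

Lemma pamul1g u g (e : pasrc (paid u) = parng g) : pamul e = g.
Proof.
apply: val_inj => /=; rewrite add0r; move: e; rewrite /pasrc /parng /= => ->.
by rewrite -!surjective_pairing.
Qed.

Lemma pamulg1 g u (e : pasrc g = parng (paid u)) : pamul e = g.
Proof.
apply: val_inj => /=; rewrite addr0; move: e; rewrite /pasrc /parng /= => <-.
by rewrite -!surjective_pairing.
Qed.

Lemma pamulVg g (e : pasrc (painv g) = parng g) : pamul e = paid (pasrc g).
Proof. by apply: val_inj => /=; rewrite addNr. Qed.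

Lemma pamulgV g (e : pasrc g = parng (painv g)) : pamul e = paid (parng g).
Proof. by apply: val_inj => /=; rewrite addrN. Qed.

Definition path_groupoid : groupoid :=
  @Groupoid path_arrow bpath parng pasrc paid painv pamul
    (fun=> erefl) (fun=> erefl) (fun=> erefl) (fun=> erefl)
    (fun _ _ _ => erefl) (fun _ _ _ => erefl)
    pamulA pamul1g pamulg1 pamulVg pamulgV.

Lemma bwcat_inj a x y : wtgt a = bwsrc x -> wtgt a = bwsrc y -> fpath a ->
  bwcat a x = bwcat a y -> x = y.
Proof.
move=> ax ay pa exy.
have [m [m1 _ am ->]] := bwcat_eq exy pa ax ay erefl (leqnn _).
have m2 : m.2 = [::].
  by have := congr1 wlen am; rewrite /wlen size_cat => /eqP; rewrite -{1}[size a.2]addn0 eqn_add2l eq_sym => /eqP/size0nil.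
have -> : m = (bwsrc y, [::]) by rewrite [m]surjective_pairing m1 m2 ay.
case: (y) => [[w es]|z] //=.
by congr Inf; apply/funext => n; rewrite nth_nil subn0.
Qed.

Lemma basic_set_open a b M : path_basis (basic_set a b M) ->
  open (basic_set a b M).
Proof. by rewrite path_arrow_openE => bB g Bg; exists (basic_set a b M); last split. Qed.

Lemma cylinder_bisection a b (g h : path_arrow) : fpath a -> fpath b ->
  cylinder a b (val g) -> cylinder a b (val h) -> parng g = parng h -> g = h.
Proof.
move=> pa pb [c [c1 c2 c3 c4 c5]] [d [d1 d2 d3 d4 d5]] gh.
have cd : val c = val d.
  by apply: (bwcat_inj c1 d1 pa); rewrite -c3 -d3; congr val.
apply: val_inj; rewrite [LHS]surjective_pairing [RHS]surjective_pairing.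
congr pair; last by apply: val_inj; rewrite c5 d5 cd.
rewrite [LHS]surjective_pairing [RHS]surjective_pairing c4 d4.
by congr pair; exact: gh.
Qed.

Lemma Cc_fibre_finite (R : realType) (f : path_groupoid -> R[i]) 
    (u : gunit path_groupoid) :
  Cc f -> finite_set ([set g : path_groupoid | grng g = u] `&` [set g | f g != 0]).
Proof.
move=> [_ cK]; set A := _ `&` _; apply: contrapT => infA.
pose F := [set S | finite_set (A `\` S)].
have FF : ProperFilter F.
  split; last split.
  - by rewrite /F /= setD0.
  - by rewrite /F /= setDT.
  - by move=> S S' FS FS'; rewrite /F /= setDIr finite_setU.
  - by move=> S S' SS' FS; apply: sub_finite_set FS; exact: setDS.
have FA : F (closure [set g | f g != 0]).
  rewrite /F /= (_ : _ `\` _ = set0) // setD_eq0 => g [_ fg].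
  exact: subset_closure.
have [g0 [_ clg0]] := cK F FF FA.
have [a [b [pa pb gab]]] := set_valP g0.
have ab : wtgt a = wtgt b by case: gab => c [-> ->].
pose B := basic_set a b set0.
have oB : open B by apply: basic_set_open; exists a, b, set0.
have nB : nbhs g0 B by apply: open_nbhs_nbhs; split=> //; split.
have FAB : F (A `\` B).
  apply: (@sub_finite_set _ _ (A `&` B)).
    by move=> g [Ag AB]; split=> //; apply: contrapT => nBg; exact: AB.
  case: (pselect (exists g, (A `&` B) g)) => [[g [[gu _] [Bg _]]]|nAB].
    apply: (@sub_finite_set _ _ [set g]) => // h [[hu _] [Bh _]].
    exact: (cylinder_bisection pa pb Bh Bg (etrans hu (esym gu))).
  by apply: (@sub_finite_set _ _ set0) => // g ABg; apply: nAB; exists g.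
by have [g [[_ nBg] /nBg]] := clg0 _ _ FAB nB.
Qed.

End Paths.

(* Main.v *)
Require Import Defs.
From mathcomp Require Import all_boot all_order all_algebra.
From mathcomp Require Import complex ring lra zify.
From mathcomp Require Import all_classical all_reals topology normedtype.

(* Fix i and let a boundary path x lose its leading edges one at a time, as long
   as they are among the first i edges of the graph and for at most i steps;
   call t the number of steps.  Spread a mass 1 over the arrows (x, n, T^n x)
   with n <= t, where T is the shift: 1/(i+1) for n < t and the remainder at
   n = t.  The function f_i is the square root of this density, cut off to the
   paths starting at one of the first i vertices.  Stopping the walk at edges
   outside a finite set makes the support compact and f_i locally constant,
   also near the finite boundary paths.  The walks from a c and b c merge after
   l(a) and l(b) steps, so the convolution of f_i and its adjoint at
   (a c, l(a) - l(b), b c) lies between 1 - max(l(a), l(b)) / (i + 1) and 1 once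
   i is large with respect to a and b. *)

Set Implicit Arguments.
Unset Strict Implicit.
Unset Printing Implicit Defensive.

(* [Defs.fpath] is shadowed by the [fpath] of path.v. *)
Import Defs.
Import Order.TTheory GRing.Theory Num.Theory.
Import numFieldNormedType.Exports.

Local Open Scope classical_set_scope.
Local Open Scope ring_scope.
Local Open Scope complex_scope.

(** * Compact open cylinders *)

Section Cylinders.
Variable E : digraph.
Implicit Types (a b m : word E) (g h : path_arrow E).

Definition arrow_cylinder a b : set (path_arrow E) :=
  [set g | cylinder a b (val g)].

Lemma arrow_cylinder_open a b : fpath a -> fpath b -> wtgt a = wtgt b ->
  open (arrow_cylinder a b).
Proof.
move=> pa pb ab; rewrite path_arrow_openE => g gab.
exists (basic_set a b set0); last by split; [split|move=> ? []].
by exists a, b, set0; split=> //; split=> // ? [].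
Qed.

(** By [cylinder_meet] the longer pair extends the shorter one by a common path, so that two
    cylinders are either nested or disjoint. *)
Lemma arrow_cylinder_sub a b a' b' g :
  fpath a -> fpath b -> wtgt a = wtgt b -> fpath a' -> fpath b' ->
  (wlen a <= wlen a')%N -> arrow_cylinder a b g -> arrow_cylinder a' b' g ->
  arrow_cylinder a' b' `<=` arrow_cylinder a b.
Proof.
move=> pa pb ab pa' pb' le gab gab'.
have [m [m1 pm -> ->]] := cylinder_meet pa pb pa' pb' gab gab' le.
by move=> h; exact: cylinder_cat.
Qed.

(** Around an arrow outside the cylinder take any cylinder [a', b']. It can meet that of [a, b] only
    if [a, b] extend [a', b'] by a common path [m]; this [m] is unique, and removing its cylinder
    leaves a basic neighbourhood. *)
Lemma arrow_cylinder_closed a b : fpath a -> fpath b -> wtgt a = wtgt b ->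
  closed (arrow_cylinder a b).
Proof.
move=> pa pb ab; rewrite -openC path_arrow_openE => g ngab.
have [a' [b' [pa' pb' gab']]] := set_valP g.
have ab' : wtgt a' = wtgt b' by case: gab' => c [-> ->].
pose M := [set m | [/\ fpath m, m.1 = wtgt a', a = wcat a' m & b = wcat b' m]].
exists (basic_set a' b' M).
  exists a', b', M; split=> //; split; last by move=> m [].
  apply: (@sub_finite_set _ _ [set (wtgt a', drop (wlen a') a.2)]) => // m.
  move=> [pm m1 -> _] /=.
  by rewrite drop_size_cat // -m1 -surjective_pairing.
split.
  by split=> // m [_ _ am bm]; rewrite -am -bm; exact: ngab.
move=> h [hab' hM] hab.
have [le|/ltnW le] := leqP (wlen a) (wlen a').
  by apply: ngab; exact: (arrow_cylinder_sub pa pb ab pa' pb' le hab hab').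
have [m [m1 pm am bm]] := cylinder_meet pa' pb' pa pb hab' hab le.
by apply: (hM m); [split|rewrite -am -bm].
Qed.

(** A basic set is a cylinder minus finitely many cylinders, and an ultrafilter contains the
    complement of each cylinder that it does not contain. *)
Lemma cvg_arrow_cylinder (F : set_system (path_arrow E)) g : UltraFilter F ->
  (forall a b, fpath a -> fpath b -> wtgt a = wtgt b ->
    F (arrow_cylinder a b) <-> arrow_cylinder a b g) ->
  F --> g.
Proof.
move=> FU FP A; rewrite nbhsE => -[U [oU Ug] UA].
move: oU; rewrite path_arrow_openE => /(_ g Ug).
move=> [_ [a [b [M [pa pb ab [fM sM] ->]]]] [[gab gM] BU]].
apply: (filterS (subset_trans BU UA)).
have FC m : M m -> F (~` arrow_cylinder (wcat a m) (wcat b m)).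
  move=> Mm; have [pm m1] := sM _ Mm.
  have [|//] := in_ultra_setVsetC (arrow_cylinder (wcat a m) (wcat b m)) FU.
  move=> /FP h; exfalso; apply: (gM m Mm); apply: h.
  - exact: fpath_cat.
  - by apply: fpath_cat => //; rewrite -ab.
  - by rewrite !wtgt_cat // -ab.
have /finite_fsetP [N MN] := fM.
have FI : F (\bigcap_(m in M) ~` arrow_cylinder (wcat a m) (wcat b m)).
  rewrite MN; apply: filter_bigI => m mN; apply: FC; rewrite MN; exact: mN.
have FA : F (arrow_cylinder a b) by apply/FP.
by apply: filterS (filterI FA FI) => h [ha hI]; split.
Qed.

Lemma ultra_bigcup (T : Type) (I : choiceType) (F : set_system T) (D : set I)
    (A : I -> set T) : UltraFilter F -> finite_set D ->
  F (\bigcup_(i in D) A i) -> exists2 i, D i & F (A i).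
Proof.
move=> FU /finite_fsetP [N DN] FA; apply: contrapT => nF.
have FC : F (\bigcap_(i in D) ~` A i).
  rewrite DN; apply: filter_bigI => i iN.
  have [FAi|//] := in_ultra_setVsetC (A i) FU.
  by exfalso; apply: nF; exists i => //; rewrite DN.
have [x [[i Di Aix] xC]] := filter_ex (filterI FA FC).
exact: xC Di Aix.
Qed.

Definition to_bpath (x : bword E) (h : boundary x) : bpath E :=
  exist (fun x => x \in @boundary E) x (mem_set h).

Definition bedge (x : bword E) (j : nat) : option (edge E) :=
  match x with Fin c => onth c.2 j | Inf z => Some (z j) end.

Lemma bedge0_Some (c : bpath E) e : bedge (val c) 0 = Some e ->
  exists c' : bpath E, [/\ bwsrc (val c) = esrc e, etgt e = bwsrc (val c')
    & val c = bwcat (esrc e, [:: e]) (val c')].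
Proof.
have := set_valP c; case: (val c) => [[v [|f es]]|z] //=.
  move=> [[/= <- pes] ie] [<-].
  have h : boundary (Fin (etgt f, es)) by split.
  by exists (to_bpath h).
move=> zP [<-].
have h : boundary (Inf (fun n => z n.+1)) by move=> n; exact: zP.
exists (to_bpath h); split=> //=; congr Inf; apply/funext => -[|n] //=.
by rewrite nth_nil /wlen /= subn1.
Qed.

Lemma bedge0_None (c : bpath E) : bedge (val c) 0 = None ->
  val c = Fin (bwsrc (val c), [::]) /\ infinite_emitter (bwsrc (val c)).
Proof. by have := set_valP c; case: (val c) => [[v [|f es]]|z] //= [_]. Qed.

Lemma cylinder_point a b (c : bpath E) : fpath a -> fpath b ->
  wtgt a = bwsrc (val c) -> wtgt b = bwsrc (val c) ->
  exists g, [/\ val (val g).1.1 = bwcat a (val c),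
    (val g).1.2 = (wlen a)%:Z - (wlen b)%:Z & val (val g).2 = bwcat b (val c)].
Proof.
move=> pa pb ac bc; have [x xE] := bpath_cat pa ac; have [y yE] := bpath_cat pb bc.
have h : path_triple (x, (wlen a)%:Z - (wlen b)%:Z, y).
  by exists a, b; split=> //; exists c.
by exists (to_arrow h).
Qed.

Lemma wcat0 a v : wcat a (v, [::]) = a.
Proof. by rewrite /wcat /= cats0 -surjective_pairing. Qed.

Lemma wcatA a m n : wcat (wcat a m) n = wcat a (wcat m n).
Proof. by rewrite /wcat /= catA. Qed.

Lemma wlen_cat a m : wlen (wcat a m) = (wlen a + wlen m)%N.
Proof. exact: size_cat. Qed.

Lemma wtgt_ext a v e : wtgt (wcat a (v, [:: e])) = etgt e.
Proof. by rewrite /wtgt /= map_cat last_cat. Qed.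

Definition wext m e : word E := wcat m (wtgt m, [:: e]).

(* An ultrafilter containing a cylinder converges along the tree of words [m]
   whose cylinder it contains: to a finite path if this tree has a leaf, and to
   an infinite path otherwise. *)
Section UltrafilterLimit.
Variables (F : set_system (path_arrow E)) (a b : word E).
Hypotheses (FU : UltraFilter F) (pa : fpath a) (pb : fpath b)
  (ab : wtgt a = wtgt b).

Definition ultra_prefix m :=
  [/\ fpath m, m.1 = wtgt a & F (arrow_cylinder (wcat a m) (wcat b m))].

Lemma ultra_prefix_paths m : ultra_prefix m ->
  [/\ fpath (wcat a m), fpath (wcat b m), wtgt (wcat a m) = wtgt m
    & wtgt (wcat b m) = wtgt m].
Proof.
by move=> [pm m1 _]; split; do ?apply: fpath_cat => //; rewrite ?wtgt_cat // -ab.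
Qed.

Lemma ultra_prefix_ext m e : ultra_prefix m -> esrc e = wtgt m ->
  F (arrow_cylinder (wcat (wcat a m) (wtgt m, [:: e]))
                    (wcat (wcat b m) (wtgt m, [:: e]))) ->
  ultra_prefix (wext m e).
Proof. by move=> [pm m1 _] em Fe; split; rewrite -?wcatA //; apply: fpath_cat. Qed.

(** A cylinder [a', b'] is compared with that of a prefix [m]. If [a m] is at least as long as [a'],
    the two are nested or disjoint, which settles both directions. If [m] is a shorter leaf, the
    range of [g] is too short for the cylinder, and if [F] contained the cylinder, the edge of [a']
    following [a m] would extend [m]. *)
Lemma cvg_ultra_prefix g :
  (forall n, exists m, [/\ ultra_prefix m,
    arrow_cylinder (wcat a m) (wcat b m) g &
    (n <= wlen (wcat a m))%N \/
    (val (val g).1.1 = Fin (wcat a m) /\ forall e, ~ ultra_prefix (wext m e))]) ->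
  F --> g.
Proof.
move=> gP; apply: cvg_arrow_cylinder => a' b' pa' pb' ab'.
have [m [um gm]] := gP (wlen a').
have [pam pbm am bm] := ultra_prefix_paths um.
have Fm : F (arrow_cylinder (wcat a m) (wcat b m)) by case: um.
have abm : wtgt (wcat a m) = wtgt (wcat b m) by rewrite am.
case: (leqP (wlen a') (wlen (wcat a m))) => [le _|lt].
  split=> [F'|g'].
    have [h [h' hm]] := filter_ex (filterI F' Fm).
    exact: (arrow_cylinder_sub pa' pb' ab' pam pbm le h' hm).
  apply: filterS Fm.
  exact: (arrow_cylinder_sub pa' pb' ab' pam pbm le g' gm).
case=> [//|[gE nm]]; split=> [F'|[c [c1 c2 c3 _ _]]]; last first.
  move: c3 lt; rewrite gE; case: (val c) => [d|//] -[_ dE].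
  by rewrite [X in (X < _)%N]/wlen /= dE size_cat ltnNge leq_addr.
have [h [h' hm]] := filter_ex (filterI F' Fm).
have [k [k1 pk ak bk]] := cylinder_meet pam pbm pa' pb' hm h' (ltnW lt).
case: k k1 pk ak bk => v [|e es] /= vE.
  by move=> _ aE; move: lt; rewrite aE wcat0 ltnn.
move=> [ev pes] aE bE; exfalso; apply: (nm e).
have em : esrc e = wtgt m by rewrite ev vE am.
apply: (ultra_prefix_ext um em).
apply: filterS F'; rewrite aE bE.
have kE : (v, e :: es) = wcat (wtgt m, [:: e]) (etgt e, es).
  by rewrite /wcat /= vE am.
rewrite kE -!wcatA => h1; apply: cylinder_cat => //.
  by rewrite !wtgt_ext.
by rewrite wtgt_ext.
Qed.

(** If only finitely many edges left the end of [m], no boundary path could end there. The cylinder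
    of [m] would then be the finite union of its extensions by one edge, and the ultrafilter would
    contain one of these. *)
Lemma ultra_prefix_maximal m : ultra_prefix m ->
  (forall e, ~ ultra_prefix (wext m e)) -> infinite_emitter (wtgt m).
Proof.
move=> um nm fin.
have [pam pbm am bm] := ultra_prefix_paths um.
have Fm : F (arrow_cylinder (wcat a m) (wcat b m)) by case: um.
have : F (\bigcup_(e in [set e | esrc e = wtgt m])
    arrow_cylinder (wcat (wcat a m) (wtgt m, [:: e]))
                   (wcat (wcat b m) (wtgt m, [:: e]))).
  apply: filterS Fm => h [c [c1 c2 c3 c4 c5]].
  case eqe : (bedge (val c) 0) => [e|]; last first.
    by have [_] := bedge0_None eqe; rewrite -c1 am => /(_ fin).
  have [c' [s1 s2 s3]] := bedge0_Some eqe.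
  have em : esrc e = wtgt m by rewrite -s1 -c1.
  exists e => //; exists c'; split.
  - by rewrite wtgt_ext s2.
  - by rewrite wtgt_ext s2.
  - by rewrite c3 s3 em -bwcatA.
  - rewrite c4 !wlen_cat !PoszD; ring.
  - by rewrite c5 s3 em -bwcatA.
move=> /(ultra_bigcup FU fin)[e em Fe].
exact: (nm e) (ultra_prefix_ext um em Fe).
Qed.

Lemma ultra_prefix_limit : F (arrow_cylinder a b) ->
  exists2 g, arrow_cylinder a b g & F --> g.
Proof.
move=> Fab.
have u0 : ultra_prefix (wtgt a, [::]) by split=> //; rewrite !wcat0.
case: (pselect (exists2 m, ultra_prefix m & forall e, ~ ultra_prefix (wext m e))).
  move=> [m um nm]; have [pam pbm am bm] := ultra_prefix_paths um.
  have cP : boundary (Fin (wtgt m, [::])).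
    by split=> //; exact: (ultra_prefix_maximal um nm).
  have [g [g1 g2 g3]] := cylinder_point (c := to_bpath cP) pam pbm am bm.
  have gm : arrow_cylinder (wcat a m) (wcat b m) g by exists (to_bpath cP).
  exists g; first by case: um => pm m1 _; apply: (cylinder_cat ab pm m1 gm).
  apply: cvg_ultra_prefix => n; exists m; split=> //; right; split=> //.
  by rewrite g1 /= wcat0.
move=> nmax.
have ext m : ultra_prefix m -> exists e, ultra_prefix (wext m e).
  by move=> um; apply: contrapT => nm; apply: nmax; exists m => // e ue; apply: nm; exists e.
(* The edge [e0] serves as the value of the choice function at words outside the tree. *)
have [e0 _] := ext _ u0.
have /choice[s sP] m : exists e, ultra_prefix m -> ultra_prefix (wext m e).
  by case: (pselect (ultra_prefix m)) => [/ext[e ue]|num]; [exists e|exists e0].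
(* A tree without leaves has an infinite branch [ms], whose edges form the infinite path [z]; the
   limit is the arrow from [b z] to [a z]. *)
pose ms n := iter n (fun m => wext m (s m)) (wtgt a, [::]).
pose z n := s (ms n).
have ums n : ultra_prefix (ms n) by elim: n => //= n; exact: sP.
have msE n : ms n = (wtgt a, mkseq z n).
  by elim: n => //= n IH; rewrite mkseqS -cats1 [in LHS]IH /wext /wcat /= -IH.
have msz n : esrc (z n) = wtgt (ms n).
  by have [+ _ _] := ums n.+1; rewrite /= /wext => /is_chain_cat[_ []].
have zP : boundary (Inf z).
  move=> n; have [+ _ _] := ums n.+2.
  rewrite msE => pm; have {pm} : is_chain (wtgt a) (mkseq z n.+2) by [].
  rewrite mkseqS -cats1 => /is_chain_cat[_ [-> _]].
  by rewrite /wtgt mkseqS -cats1 map_cat last_cat.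
have zsP n : boundary (Inf (fun i => z (n + i)%N)).
  by move=> i; rewrite addnS; exact: zP.
have zE n : Inf z = bwcat (ms n) (Inf (fun i => z (n + i)%N)).
  congr Inf; apply/funext => i; rewrite msE /wlen /= size_mkseq.
  case: (ltnP i n) => lt; first by rewrite nth_mkseq.
  by rewrite nth_default ?size_mkseq // subnKC.
have az : wtgt a = bwsrc (val (to_bpath zP)) by rewrite /= msz.
have bz : wtgt b = bwsrc (val (to_bpath zP)) by rewrite -ab.
have [g [g1 g2 g3]] := cylinder_point pa pb az bz.
exists g; first by exists (to_bpath zP).
apply: cvg_ultra_prefix => n; exists (ms n); split=> //.
  have [pam pbm am bm] := ultra_prefix_paths (ums n).
  exists (to_bpath (zsP n)); split.
  - by rewrite am -msz /= addn0.
  - by rewrite bm -msz /= addn0.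
  - by rewrite g1 bwcatA -zE.
  - rewrite g2 !wlen_cat !PoszD; ring.
  - by rewrite g3 bwcatA -zE.
by left; rewrite wlen_cat msE {2}/wlen /= size_mkseq leq_addl.
Qed.

End UltrafilterLimit.

Lemma arrow_cylinder_compact a b : fpath a -> fpath b -> wtgt a = wtgt b ->
  compact (arrow_cylinder a b).
Proof.
move=> pa pb ab; rewrite compact_ultra => F FU Fab.
by have [g gab Fg] := ultra_prefix_limit FU pa pb ab Fab; exists g.
Qed.

End Cylinders.

(** * Stopped walks *)

Section InitialRun.
Local Open Scope nat_scope.
Implicit Types P : pred nat.

(** [find] returns the size of the list when nothing is found, so a run without failure has length
    [N]. *)
Definition run (P : pred nat) (N : nat) : nat := find (predC P) (iota 0 N).

Lemma run_le P N : run P N <= N.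
Proof. by rewrite -[leqRHS](size_iota 0); exact: find_size. Qed.

Lemma run_lt P N j : j < run P N -> P j.
Proof.
move=> lt; have := before_find 0 lt.
by rewrite nth_iota ?(leq_trans lt (run_le _ _)) // => /negbFE.
Qed.

Lemma run_stop P N : run P N < N -> ~~ P (run P N).
Proof.
move=> lt; have : has (predC P) (iota 0 N) by rewrite has_find size_iota.
by move=> /(nth_find 0); rewrite nth_iota.
Qed.

Lemma run_unique P N d : d <= N -> (forall j, j < d -> P j) ->
  (d < N -> ~~ P d) -> run P N = d.
Proof.
move=> dN Pd nPd; apply/eqP; rewrite eqn_leq; apply/andP; split.
  rewrite leqNgt; apply/negP => lt.
  by move: (run_lt lt); apply/negP/nPd/(leq_trans lt (run_le _ _)).
rewrite leqNgt; apply/negP => lt.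
by move: (Pd _ lt); apply/negP/run_stop/(leq_trans lt).
Qed.

Lemma run_min P m n : m <= n -> run P m = minn (run P n) m.
Proof.
move=> mn; apply: run_unique; first exact: geq_minr.
  by move=> j; rewrite leq_min => /andP[/run_lt].
rewrite gtn_min ltnn orbF => lt; rewrite (minn_idPl (ltnW lt)).
exact/run_stop/(leq_trans lt).
Qed.

Lemma run_shift P k N : (forall j, j < k -> P j) -> k <= N ->
  run P N = k + run (fun j => P (k + j)) (N - k).
Proof.
move=> Pk kN; apply: run_unique.
- by rewrite -leq_subRL // run_le.
- move=> j; case: (ltnP j k) => [/Pk//|kj].
  by rewrite -ltn_subLR // => /run_lt; rewrite subnKC.
- by rewrite -ltn_subRL; exact: run_stop.
Qed.

Lemma run_gt P N n : n <= run P N -> (n < run P N) = (n < N) && P n.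
Proof.
move=> le; apply/idP/andP => [lt|[nN Pn]].
  by split; [exact: leq_trans lt (run_le _ _)|exact: run_lt lt].
rewrite ltn_neqAle le andbT; apply/eqP => nE.
by move: nN Pn; rewrite nE => /run_stop/negP.
Qed.

(* The mass, in units of 1/(i+1), at distance [n] from the start of a walk of
   at most [i] steps that is stopped after [t] of them. *)
Definition weight (i t n : nat) : nat :=
  if n < t then 1 else if n == t then i.+1 - t else 0.

(** Every position before [t] counts 1, and the remainder at [t] completes the total [i + 1]. *)
Lemma sum_weight i t M : t <= i ->
  \sum_(n < M) weight i t n = if M <= t then M else i.+1.
Proof.
move=> ti; elim: M => [|M IH]; first by rewrite big_ord0.
rewrite big_ord_recr /= IH /weight; case: (ltngtP M t) => [lt|lt|->].
- by rewrite addn1.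
- by rewrite addn0.
- by rewrite subnKC // ltnW.
Qed.

Lemma sum_weight_le i t M : t <= i -> \sum_(n < M) weight i t n <= i.+1.
Proof.
by move=> ti; rewrite sum_weight //; case: (leqP M t) => // Mt; apply: leq_trans Mt (leqW ti).
Qed.

Lemma leq_sum_ord (f : nat -> nat) m n : m <= n ->
  \sum_(j < m) f j <= \sum_(j < n) f j.
Proof.
by move=> mn; rewrite -(subnKC mn) big_split_ord /= leq_addr.
Qed.

Lemma leq_sum_shift (f : nat -> nat) k M :
  \sum_(j < M) f (k + j) <= \sum_(j < k + M) f j.
Proof. by rewrite big_split_ord /= leq_addl. Qed.

(** Position [n] of one walk is matched with position [l + n - k] of another. Distinct [n] meet
    distinct positions, so only part of the total mass of the second walk is counted. *)
Lemma sum_weight_shift i t k l M : t <= i ->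
  \sum_(n < M) (if k <= l + n then weight i t (l + n - k) else 0) <= i.+1.
Proof.
move=> ti; pose f j := if k <= j then weight i t (j - k) else 0.
apply: leq_trans (leq_sum_shift f l M) _.
apply: (@leq_trans (\sum_(j < k + (l + M)) f j)).
  by apply: leq_sum_ord; rewrite leq_addl.
rewrite big_split_ord /= big1 ?add0n; last first.
  by move=> j _; rewrite /f leqNgt ltn_ord.
under eq_bigr do rewrite /f leq_addr addKn.
exact: sum_weight_le.
Qed.

(** Both sides concern the point at distance [j] on a common tail of depth [D], reached after a
    prefix of length [K] or [k]. Before the stopping points both weights are 1. If the longer walk
    stops first, it has exhausted its [i] steps and its remainder is 1; if both stop at the same
    point, the shorter prefix leaves the larger remainder. *)
Lemma weight_overlap i D k K j : k <= K -> K <= i -> j <= minn D (i - K) ->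
  weight i (K + minn D (i - K)) (K + j) <= weight i (k + minn D (i - k)) (k + j).
Proof.
move=> kK Ki; have : minn D (i - K) <= minn D (i - k) by lia.
have : minn D (i - K) < minn D (i - k) -> minn D (i - K) = i - K by lia.
rewrite /weight !ltn_add2l !eqn_add2l.
case: (ltngtP j (minn D (i - K))) => //.
  by move=> lt _ le _; rewrite (leq_trans lt le).
by move=> -> h; case: ltngtP => // [/h -> _ _|-> _ _]; lia.
Qed.

(** Of the total mass [i + 1], one unit is spent at each of the first [K] positions. *)
Lemma sum_weight_tail i d K : K + d <= i ->
  \sum_(j < d.+1) weight i (K + d) (K + j) = i.+1 - K.
Proof.
move=> le; have := sum_weight (K + d).+1 le; rewrite ltnn -addnS big_split_ord /=.
have := sum_weight K le; rewrite leq_addr => ->; lia.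
Qed.

End InitialRun.

(** * The shift on boundary paths and the stopping time of a walk *)

Section Shift.
Variable E : digraph.
Implicit Types (a b : word E) (x y c : bpath E).

(** Beyond the end of a finite path the result is its terminal vertex, so the shift is total. *)
Definition bdrop (n : nat) (x : bword E) : bword E :=
  match x with
  | Fin c => Fin (wtgt (c.1, take n c.2), drop n c.2)
  | Inf z => Inf (fun j => z (n + j)%N)
  end.

Lemma bdrop_boundary n (x : bword E) : boundary x -> boundary (bdrop n x).
Proof.
case: x => [[v es]|z] /=; last by move=> zP j; rewrite addnS.
move=> [p ie]; split.
  by move: p; rewrite /fpath /= -{1}(cat_take_drop n es) => /is_chain_cat[].
have := ie; rewrite -{1}(cat_take_drop n es).
by rewrite -(@wtgt_cat _ (v, take n es) (wtgt (v, take n es), drop n es)).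
Qed.

Lemma bdrop_cat a (x : bword E) n : wtgt a = bwsrc x ->
  bdrop (wlen a + n) (bwcat a x) = bdrop n x.
Proof.
case: x => [c|z] /= ac.
  rewrite take_cat drop_cat /wlen ltnNge leq_addr /= addKn; congr (Fin (_, _)).
  by rewrite -ac /wtgt /= map_cat last_cat.
congr Inf; apply/funext => j.
by rewrite nth_default -?addnA ?leq_addr // addKn.
Qed.

Definition bshift (n : nat) x : bpath E := to_bpath (bdrop_boundary n (set_valP x)).

Lemma bshift_cat a x c n : wtgt a = bwsrc (val c) -> val x = bwcat a (val c) ->
  bshift (wlen a + n) x = bshift n c.
Proof. by move=> ac xE; apply: val_inj => /=; rewrite xE bdrop_cat. Qed.

Lemma bshift0 x : bshift 0 x = x.
Proof.
apply: val_inj => /=; case: (val x) => [[v es]|z] //=.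
by rewrite take0 drop0.
Qed.

Lemma bedge_cat_l a (x : bword E) j : (j < wlen a)%N ->
  bedge (bwcat a x) j = onth a.2 j.
Proof.
case: x => [c|z] /= lt; first by rewrite !onthE map_cat nth_cat size_map lt.
by rewrite onthE (nth_map (z (j - wlen a)%N)).
Qed.

Lemma bedge_cat_r a (x : bword E) j : bedge (bwcat a x) (wlen a + j) = bedge x j.
Proof.
case: x => [c|z] /=; last by rewrite nth_default ?leq_addr // addKn.
by rewrite !onthE map_cat nth_cat size_map ltnNge leq_addr /= addKn.
Qed.

Definition early (T : countType) (i : nat) (t : T) : bool := (pickle t < i)%N.

Lemma finite_early (T : countType) i : finite_set [set t : T | early i t].
Proof.
apply: (@finite_preimage _ _ `I_i pickle); last exact: finite_II.
by move=> ? ? _ _; exact: (pcan_inj pickleK).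
Qed.

Definition early_word i a : bool := early i a.1 && all (early i) a.2.

Definition early_edge i (x : bword E) (j : nat) : bool :=
  if bedge x j is Some e then early i e else false.

(** The stopping time of the walk: it ends before the first edge that is not early, at the end of a
    finite path, or after [i] steps. *)
Definition depth i x : nat := run (early_edge i (val x)) i.

Lemma early_edge_cat_l i a (x : bword E) j : early_word i a -> (j < wlen a)%N ->
  early_edge i (bwcat a x) j.
Proof.
move=> /andP[_ /allP ea] lt; rewrite /early_edge bedge_cat_l // onthE.
by case: a ea lt => v [//|e es] ea lt; rewrite (nth_map e) //; apply/ea/mem_nth.
Qed.

Lemma early_edge_cat_r i a (x : bword E) :
  (fun j => early_edge i (bwcat a x) (wlen a + j)) = early_edge i x.
Proof. by apply/funext => j; rewrite /early_edge bedge_cat_r. Qed.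

(** The walk passes through [a] and goes on along [c] with the same set of early edges, but with
    only [i - wlen a] steps left. *)
Lemma depth_cat i a x c : early_word i a -> (wlen a <= i)%N ->
  val x = bwcat a (val c) ->
  depth i x = (wlen a + minn (depth i c) (i - wlen a))%N.
Proof.
move=> ea ai xE; rewrite /depth xE (@run_shift _ (wlen a)) //; last first.
  by move=> j; exact: early_edge_cat_l.
by rewrite early_edge_cat_r (run_min _ (leq_subr _ _)).
Qed.

Lemma bwcat0 (x : bword E) : bwcat (bwsrc x, [::]) x = x.
Proof.
case: x => [[v es]|z] //=.
by congr Inf; apply/funext => n; rewrite nth_nil subn0.
Qed.

(** The edges walked over form one of finitely many words; this is what confines the support to
    finitely many cylinders. *)
Lemma depth_split i x n : early i (bwsrc (val x)) -> (n <= depth i x)%N ->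
  exists a c, [/\ fpath a, early_word i a, wlen a = n,
    wtgt a = bwsrc (val c) & val x = bwcat a (val c)].
Proof.
move=> ex; elim: n => [_|n IH lt].
  exists (bwsrc (val x), [::]), x; split=> //; first by rewrite /early_word /= ex.
  by rewrite bwcat0.
have [a [c [pa ea an ac xE]]] := IH (ltnW lt).
have := run_lt lt; rewrite xE -an -{1}[wlen a]addn0 /early_edge bedge_cat_r.
case ce : bedge => [e|//] ee.
have [c' [s1 s2 s3]] := bedge0_Some ce.
exists (wcat a (esrc e, [:: e])), c'; split.
- by apply: fpath_cat => //=; rewrite ac.
- by move: ea => /andP[a1 a2]; rewrite /early_word /= a1 all_cat a2 /= ee.
- by rewrite wlen_cat addn1.
- by rewrite wtgt_ext.
- by rewrite bwcatA -s3.
Qed.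

Lemma bshift_wlen a x c : wtgt a = bwsrc (val c) -> val x = bwcat a (val c) ->
  bshift (wlen a) x = c.
Proof. by move=> ac xE; rewrite -[wlen a]addn0 (bshift_cat _ ac xE) bshift0. Qed.

Lemma path_triple_shift i x n : early i (bwsrc (val x)) -> (n <= depth i x)%N ->
  path_triple (x, n%:Z, bshift n x).
Proof.
move=> ex /(depth_split ex)[a [c [pa ea <- ac xE]]].
rewrite (bshift_wlen ac xE); exists a, (wtgt a, [::]); split=> //.
by exists c; split=> //=; rewrite ?subr0 // ac bwcat0.
Qed.

End Shift.

(** * The approximating functions *)

(** This turns the sums over a fibre or over all factorizations of an arrow into sums over the
    positions of a walk. *)
Lemma fsum_reindex (V : nmodType) (J : choiceType) (A : set J) (F : J -> V)
    (n : nat) (h : nat -> J) :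
  (forall j, (j < n)%N -> A (h j)) ->
  (forall j k, (j < n)%N -> (k < n)%N -> h j = h k -> j = k) ->
  (forall x, A x -> F x != 0 -> exists2 j, (j < n)%N & x = h j) ->
  \sum_(x \in A) F x = \sum_(j < n) F (h j).
Proof.
move=> hA hI FA; rewrite (fsbig_ord _ _ (fun j => F (h j))).
rewrite -fsbig_image; last by move=> j k; rewrite !inE /=; exact: hI.
apply/esym/fsbig_widen; first by move=> _ [j jn <-]; exact: hA.
move=> x [Ax nx] /=; apply/eqP; apply: contrapT => /negP Fx.
by apply: nx; have [j jn ->] := FA x Ax Fx; exists j.
Qed.

Section WalkFunction.
Variables (R : realType) (E : digraph).
Implicit Types (a b : word E) (x y c : bpath E) (g : path_arrow E).

(** It is defined on all triples, so that the sums below need no proof that their triples are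
    arrows. The square root makes the squared amplitudes the density of the walk. *)
Definition walk_amplitude i (t : triple E) : R :=
  if t.1.2 is Posz n then
    if [&& early i (bwsrc (val t.1.1)), (n <= depth i t.1.1)%N
         & t.2 == bshift n t.1.1]
    then Num.sqrt ((weight i (depth i t.1.1) n)%:R / i.+1%:R) else 0
  else 0.

Definition walk_function i : path_groupoid E -> R[i] :=
  fun g => (walk_amplitude i (val (g : path_arrow E)))%:C.

Lemma walk_amplitude_ge0 i t : 0 <= walk_amplitude i t.
Proof.
rewrite /walk_amplitude; case: t => [[x [n|n]] y] //=.
by case: ifP => // _; exact: sqrtr_ge0.
Qed.

Lemma walk_amplitude_neq0 i x m y : walk_amplitude i (x, m, y) != 0 ->
  exists n, [/\ early i (bwsrc (val x)), (n <= depth i x)%N, m = n%:Z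
    & y = bshift n x].
Proof.
rewrite /walk_amplitude /=; case: m => [n|n]; last by rewrite eqxx.
by case: ifP => [/and3P[ex nd /eqP ->]|]; [exists n|rewrite eqxx].
Qed.

Lemma depth_le i x : (depth i x <= i)%N.
Proof. exact: run_le. Qed.

Lemma walk_amplitudeE i x n : early i (bwsrc (val x)) -> (n <= depth i x)%N ->
  walk_amplitude i (x, n%:Z, bshift n x) =
  Num.sqrt ((weight i (depth i x) n)%:R / i.+1%:R).
Proof. by move=> ex nd; rewrite /walk_amplitude /= ex nd eqxx. Qed.

Lemma walk_amplitude_sqr_le i x m y : walk_amplitude i (x, m, y) ^+ 2 <=
  (if m is Posz n then weight i (depth i x) n else 0%N)%:R / i.+1%:R.
Proof.
rewrite /walk_amplitude /=; case: m => [n|n]; last by rewrite expr0n mul0r.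
case: ifP => _; last by rewrite expr0n divr_ge0.
by rewrite sqr_sqrtr // divr_ge0.
Qed.

Lemma sum_natr_div_le1 (f : nat -> nat) i n : (\sum_(j < n) f j <= i.+1)%N ->
  \sum_(j < n) (f j)%:R / i.+1%:R <= 1 :> R.
Proof.
by move=> le; rewrite -mulr_suml -natr_sum ler_pdivrMr ?ltr0n // mul1r ler_nat.
Qed.

(** The unit [paid x] is a default value; [val_walk_arrow] excludes it along the walk from an early
    vertex. *)
Definition walk_arrow x n : path_arrow E := insubd (paid x) (x, n%:Z, bshift n x).

Lemma val_walk_arrow i x n : early i (bwsrc (val x)) -> (n <= depth i x)%N ->
  val (walk_arrow x n) = (x, n%:Z, bshift n x).
Proof.
by move=> ex nd; rewrite /walk_arrow val_insubd mem_set //; exact: path_triple_shift nd.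
Qed.

Lemma walk_arrow_inj i x j k : early i (bwsrc (val x)) ->
  (j < (depth i x).+1)%N -> (k < (depth i x).+1)%N ->
  walk_arrow x j = walk_arrow x k -> j = k.
Proof.
move=> ex jd kd /(congr1 (fun g => (val g).1.2)).
by rewrite !(@val_walk_arrow i) //= => -[].
Qed.

Lemma normr_walk_function i x n : early i (bwsrc (val x)) ->
  (n < (depth i x).+1)%N ->
  `|walk_function i (walk_arrow x n)| ^+ 2 =
  ((weight i (depth i x) n)%:R / i.+1%:R)%:C.
Proof.
move=> ex nd; rewrite /walk_function (val_walk_arrow ex nd) (walk_amplitudeE ex nd).
set w : R := _ / _; have w0 : 0 <= w by exact: divr_ge0.
have -> : `|(Num.sqrt w)%:C| = (Num.sqrt w)%:C.
  by apply: ger0_norm; rewrite lecR sqrtr_ge0.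
by rewrite expr2 -rmorphM -expr2 /= sqr_sqrtr.
Qed.

(** In the fibre over [x] the support consists of arrows of the walk from [x], and the squares there
    sum to at most the total mass 1. *)
Lemma walk_fibre_norm2 i x : fibre_norm2 (walk_function i) x <= 1%:C.
Proof.
rewrite /fibre_norm2; case ex : (early i (bwsrc (val x))); last first.
  rewrite fsbig1 ?lecR // => g gx; rewrite /walk_function.
  suff -> : walk_amplitude i (val (g : path_arrow E)) = 0 by rewrite normr0 expr0n.
  have : (val (g : path_arrow E)).1.1 = x by [].
  case: (val _) => [[x' m] y] /= ->; apply/eqP; apply: contrapT => /negP.
  by move=> /walk_amplitude_neq0[n []]; rewrite ex.
rewrite (@fsum_reindex _ _ _ _ (depth i x).+1 (walk_arrow x)).
- have -> : \sum_(j < (depth i x).+1) `|walk_function i (walk_arrow x j)| ^+ 2 =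
      (\sum_(j < (depth i x).+1) (weight i (depth i x) j)%:R / i.+1%:R)%:C.
    rewrite rmorph_sum; apply: eq_bigr => j _; exact: normr_walk_function.
  rewrite lecR; exact/sum_natr_div_le1/sum_weight_le/depth_le.
- move=> j jd; change ((val (walk_arrow x j)).1.1 = x).
  by rewrite (val_walk_arrow ex jd).
- by move=> j k; exact: walk_arrow_inj.
- move=> g gx; rewrite expf_eq0 /= normr_eq0 /walk_function => fg.
  have {fg} : walk_amplitude i (val (g : path_arrow E)) != 0.
    by apply: contra_neq fg => ->.
  have : (val (g : path_arrow E)).1.1 = x by [].
  case gE : (val (g : path_arrow E)) => [[x' m] y] /= xx.
  rewrite xx in gE *; move=> /walk_amplitude_neq0[n [_ nd mE yE]].
  by exists n => //; apply: val_inj; rewrite (@val_walk_arrow i) // gE mE yE.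
Qed.

Lemma path_triple_shift_mul i x n m y : early i (bwsrc (val x)) ->
  (n <= depth i x)%N -> path_triple (x, m, y) ->
  path_triple (bshift n x, m - n%:Z, y).
Proof.
move=> ex nd h; have := path_triple_inv (path_triple_shift ex nd).
by move=> /path_triple_mul /(_ h erefl); rewrite addrC.
Qed.

(** The factorization of [g] through the point that the walk from its range reaches after [n]
    steps. *)
Definition walk_factorization g n : path_arrow E * path_arrow E :=
  let: (x, m, y) := val g in
  (walk_arrow x n, insubd (paid y) (bshift n x, m - n%:Z, y)).

Lemma involution_walk_function i g : involution (walk_function i) g =
  (walk_amplitude i ((val g).2, - (val g).1.2, (val g).1.1))%:C.
Proof. exact: conjc_real. Qed.

(** A nonzero value at the first factor forces it to be an arrow of the walk from the range of [g];
    the first factor then determines the second. The adjoint inverts the second factor, which gives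
    the lag [n - m]. *)
Lemma walk_convolution i g : early i (bwsrc (val (val g).1.1)) ->
  convolution (walk_function i) (involution (walk_function i)) g =
  (\sum_(n < (depth i (val g).1.1).+1)
    walk_amplitude i ((val g).1.1, n%:Z, bshift n (val g).1.1) *
    walk_amplitude i ((val g).2, n%:Z - (val g).1.2, bshift n (val g).1.1))%:C.
Proof.
case gE : (val g) => [[x m] y] /= ex.
have val2 n : (n <= depth i x)%N ->
    val (walk_factorization g n).2 = (bshift n x, m - n%:Z, y).
  move=> nd; rewrite /walk_factorization gE val_insubd mem_set //.
  by apply: path_triple_shift_mul nd _ => //; rewrite -gE; exact: set_valP.
have val1 n : (n <= depth i x)%N ->
    val (walk_factorization g n).1 = (x, n%:Z, bshift n x).
  by move=> nd; rewrite /walk_factorization gE (@val_walk_arrow i).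
rewrite /convolution.
rewrite (@fsum_reindex _ _ _ _ (depth i x).+1 (walk_factorization g)).
- rewrite rmorph_sum; apply: eq_bigr => n _.
  have nd : (n <= depth i x)%N by rewrite -ltnS.
  by rewrite involution_walk_function /walk_function (val1 _ nd) (val2 _ nd) opprB rmorphM.
- move=> n nd; have e : pasrc (walk_factorization g n).1 =
      parng (walk_factorization g n).2.
    by rewrite /pasrc /parng val1 // val2.
  exists e; apply: val_inj; rewrite /= val1 // val2 //= gE.
  by rewrite addrC subrK.
- move=> j k jd kd /(congr1 (fun p => (val p.1).1.2)).
  by rewrite !val1 //= => -[].
- move=> [g1 g2] [/= e g12]; rewrite mulf_eq0 negb_or => /andP[fg _].
  have {fg} : walk_amplitude i (val g1) != 0.
    by apply: contra_neq fg; rewrite /walk_function => ->.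
  have [xx mm yy] : [/\ (val g1).1.1 = x, (val g1).1.2 + (val g2).1.2 = m
      & (val g2).2 = y] by have := congr1 val g12; rewrite gE => -[].
  have : (val g1).2 = (val g2).1.1 := e.
  clear e g12.
  case g1E : (val g1) xx mm => [[x' m'] z] /= xx mm e; rewrite xx in g1E *; move=> /walk_amplitude_neq0[n [_ nd mE zE]].
  exists n => //; rewrite [RHS]surjective_pairing; congr pair; apply: val_inj.
    by rewrite g1E val1 // mE zE.
  rewrite val2 // [LHS]surjective_pairing yy; congr pair.
  rewrite [LHS]surjective_pairing; congr pair.
    by rewrite -e zE.
  by rewrite -mm mE addrC addKr.
Qed.

End WalkFunction.

(** * Bounds for the overlap of two walks *)

Section Overlap.
Variables (R : realType) (E : digraph).
Implicit Types (a b : word E) (x y c : bpath E) (g : path_arrow E).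

(** The inner product of the square roots of two densities, those of the walks from [x] and from
    [y], taken over the points of the first walk. *)
Definition walk_overlap i x m y : R :=
  \sum_(n < (depth i x).+1) walk_amplitude R i (x, n%:Z, bshift n x) *
    walk_amplitude R i (y, n%:Z - m, bshift n x).

(** By the inequality between [p * q] and half of [p ^+ 2 + q ^+ 2], it suffices that each family of
    squares sums to at most 1. *)
Lemma walk_overlap_le1 i x k l y : walk_overlap i x (k%:Z - l%:Z) y <= 1.
Proof.
pose v n := if (k <= l + n)%N then weight i (depth i y) (l + n - k) else 0%N.
have le n : walk_amplitude R i (x, n%:Z, bshift n x) *
    walk_amplitude R i (y, n%:Z - (k%:Z - l%:Z), bshift n x) <=
    2^-1 * ((weight i (depth i x) n)%:R / i.+1%:R + (v n)%:R / i.+1%:R).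
  set p := walk_amplitude _ _ _; set q := walk_amplitude _ _ _.
  have pq : p * q <= 2^-1 * (p ^+ 2 + q ^+ 2) by have := sqr_ge0 (p - q); nra.
  apply: le_trans pq _; rewrite ler_pM2l ?invr_gt0 ?ltr0n //; apply: lerD; first exact: walk_amplitude_sqr_le.
  apply: le_trans (walk_amplitude_sqr_le _ _ _ _ _) _.
  rewrite ler_pM2r ?invr_gt0 ?ltr0n // ler_nat /v.
  case: (leqP k (l + n)) => kl.
    by have -> : n%:Z - (k%:Z - l%:Z) = (l + n - k)%N by lia.
  by case nE : (n%:Z - (k%:Z - l%:Z)) => [q'|q'] //; move: nE; lia.
apply: le_trans (ler_sum _ (fun (j : 'I__) _ => le j)) _.
have := @sum_natr_div_le1 R (weight i (depth i x)) i _ (sum_weight_le (depth i x).+1 (depth_le i x)).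
have := @sum_natr_div_le1 R v i _ (sum_weight_shift k l (depth i x).+1 (depth_le i y)).
rewrite -mulr_sumr big_split /=; lra.
Qed.

(** After the prefixes [a] and [b] both walks run along [c]. There each of the two amplitudes is at
    least that of a walk whose prefix has the larger length [K], and such a walk has mass
    [1 - K / (i + 1)] left on [c]. *)
Lemma walk_overlap_ge i x y a b c : early_word i a -> early_word i b ->
  fpath a -> fpath b -> (maxn (wlen a) (wlen b) <= i)%N ->
  wtgt a = bwsrc (val c) -> wtgt b = bwsrc (val c) ->
  val x = bwcat a (val c) -> val y = bwcat b (val c) ->
  1 - (maxn (wlen a) (wlen b))%:R / i.+1%:R <=
  walk_overlap i x ((wlen a)%:Z - (wlen b)%:Z) y.
Proof.
move=> ea eb pa pb Ki ac bc xE yE.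
have ex : early i (bwsrc (val x)) by rewrite xE bwsrc_cat //; case/andP: ea.
have ey : early i (bwsrc (val y)) by rewrite yE bwsrc_cat //; case/andP: eb.
have ai : (wlen a <= i)%N by apply: leq_trans Ki; exact: leq_maxl.
have bi : (wlen b <= i)%N by apply: leq_trans Ki; exact: leq_maxr.
have dx := depth_cat ea ai xE; have dy := depth_cat eb bi yE.
set K := maxn _ _ in Ki *; set D := depth i c in dx dy.
(* The number of steps along [c] left to a walk with a prefix of length [K]. *)
pose d := minn D (i - K).
have dle k : (k <= K)%N -> (d <= minn D (i - k))%N by rewrite /d; lia.
(* Only the positions from [wlen a] to [wlen a + d] are kept; the terms before and after them are
   nonnegative. *)
rewrite /walk_overlap -(@subnKC (wlen a + d.+1) (depth i x).+1); last first.
  by rewrite dx addnS ltnS leq_add2l dle // leq_maxl.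
rewrite -addnA big_split_ord /= ler_wpDl ?sumr_ge0 //.
  by move=> j _; rewrite mulr_ge0 // walk_amplitude_ge0.
rewrite big_split_ord /= ler_wpDr ?sumr_ge0 //.
  by move=> j _; rewrite mulr_ge0 // walk_amplitude_ge0.
have Kd : (K + d <= i)%N by rewrite /d; lia.
have -> : 1 - K%:R / i.+1%:R =
    \sum_(j < d.+1) (weight i (K + d) (K + j))%:R / i.+1%:R :> R.
  rewrite -mulr_suml -natr_sum sum_weight_tail // natrB; last exact: leqW.
  by rewrite mulrBl divff ?pnatr_eq0.
apply: ler_sum => j _; have jd : (j <= d)%N by rewrite -ltnS.
have -> : (wlen a + j)%:Z - ((wlen a)%:Z - (wlen b)%:Z) = (wlen b + j)%N by lia.
rewrite walk_amplitudeE //; last by rewrite dx leq_add2l (leq_trans jd) ?dle ?leq_maxl.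
rewrite (bshift_cat j ac xE) -(bshift_cat j bc yE).
rewrite walk_amplitudeE //; last by rewrite dy leq_add2l (leq_trans jd) ?dle ?leq_maxr.
set w := (weight i (K + d) _)%:R / _.
have w0 : 0 <= w by exact: divr_ge0.
(* Each of the two amplitudes is compared separately with the square root of [w]. *)
rewrite -[w]sqr_sqrtr // expr2.
by apply: ler_pM; rewrite ?sqrtr_ge0 // ler_wsqrtr // ler_pM2r ?invr_gt0 ?ltr0n //
  ler_nat ?dx ?dy weight_overlap ?leq_maxl ?leq_maxr.
Qed.

Lemma walk_convolution_near1 i a b g : early_word i a -> early_word i b ->
  fpath a -> fpath b -> (maxn (wlen a) (wlen b) <= i)%N ->
  arrow_cylinder a b g ->
  `|convolution (walk_function R i) (involution (walk_function R i)) g - 1| <=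
  ((maxn (wlen a) (wlen b))%:R / i.+1%:R)%:C.
Proof.
move=> ea eb pa pb Ki [c [ac bc xE mE yE]].
have ex : early i (bwsrc (val (val g).1.1)).
  by rewrite xE bwsrc_cat //; case/andP: ea.
rewrite (walk_convolution R ex).
rewrite -/(walk_overlap i (val g).1.1 (val g).1.2 (val g).2) mE.
have := walk_overlap_ge ea eb pa pb Ki ac bc xE yE.
have := walk_overlap_le1 i (val g).1.1 (wlen a) (wlen b) (val g).2.
set w := walk_overlap _ _ _ _ => w1 w2.
have -> : w%:C - 1 = - (1 - w)%:C by rewrite rmorphB opprB.
by rewrite normrN ger0_norm lecR ?subr_ge0 // lerBlDl -lerBlDr.
Qed.

End Overlap.

(** * Continuity and compact support *)

(** The sets [A i] cut the space into finitely many clopen pieces on which [f] is constant. *)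
Lemma continuous_finite_clopen (T U : topologicalType) (I : choiceType)
    (D : set I) (A : I -> set T) (f : T -> U) : finite_set D ->
  (forall i, D i -> open (A i) /\ closed (A i)) ->
  (forall g h, (forall i, D i -> A i g <-> A i h) -> f g = f h) ->
  continuous f.
Proof.
move=> /finite_fsetP[N DN] AP fA g; apply: cvg_near_cst.
have nearA i : D i -> \forall h \near g, A i g <-> A i h.
  move=> Di; have [oA cA] := AP i Di; case: (pselect (A i g)) => Ag.
    by apply: filterS (open_nbhs_nbhs (conj oA Ag)) => h Ah; split.
  have oC : open (~` A i) by rewrite openC.
  by apply: filterS (open_nbhs_nbhs (conj oC Ag)) => h Ah; split.
have nearD : \forall h \near g, (\bigcap_(i in D) [set h | A i g <-> A i h]) h.
  by rewrite DN; apply: filter_bigI => i iN; apply: nearA; rewrite DN; exact: iN.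
by apply: filterS nearD => h hA; apply/esym/fA => i Di; exact: hA.
Qed.

Lemma finite_seq_over (T : eqType) (A : set T) n : finite_set A ->
  finite_set [set s : seq T | (forall x, x \in s -> A x) /\ (size s <= n)%N].
Proof.
move=> fA; elim: n => [|n IH].
  by apply: (@sub_finite_set _ _ [set [::]]) => // s [_]; rewrite leqn0 => /nilP.
apply: (@sub_finite_set _ _ ([set [::]] `|` [set x :: s | x in A & s in
    [set s : seq T | (forall x, x \in s -> A x) /\ (size s <= n)%N]])).
  move=> [|x s] [sA sn]; [by left|right].
  exists x; first by apply: sA; rewrite mem_head.
  by exists s => //; split=> // y ys; apply: sA; rewrite inE ys orbT.
by rewrite finite_setU; split=> //; exact: finite_image2.
Qed.

Section CompactSupport.
Variables (R : realType) (E : digraph).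
Implicit Types (a b : word E) (x y c : bpath E) (g h : path_arrow E).

Definition early_path i : set (word E) :=
  [set a | [/\ fpath a, early_word i a & (wlen a <= i)%N]].

Lemma finite_early_path i : finite_set (early_path i).
Proof.
have fB := finite_setX (finite_early (vertex E) i)
  (finite_seq_over i (finite_early (edge E) i)).
by apply: sub_finite_set fB => a [_ /andP[a1 /allP a2] ai].
Qed.

Definition shift_cylinder a : set (path_arrow E) :=
  arrow_cylinder a (wtgt a, [::]).

(** When [e] leaves the end of the path [a], this is the part of [shift_cylinder a] where [e] is the
    next edge. *)
Definition step_cylinder a (e : edge E) : set (path_arrow E) :=
  arrow_cylinder (wcat a (wtgt a, [:: e])) (wtgt a, [:: e]).

Lemma shift_cylinderP a g : shift_cylinder a g <-> exists c,
  [/\ wtgt a = bwsrc (val c), val (val g).1.1 = bwcat a (val c),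
      (val g).1.2 = (wlen a)%:Z & (val g).2 = c].
Proof.
split=> [[c [ac _ xE mE yE]]|[c [ac xE mE yE]]]; exists c.
  split=> //; first by rewrite mE subr0.
  by apply: val_inj; rewrite yE ac bwcat0.
by split=> //; rewrite ?mE ?subr0 // yE ac bwcat0.
Qed.

(** Since only finitely many edges are early, finitely many cylinders decide whether the walk may
    continue past [a]. *)
Lemma early_edge_step i a c g : early_word i a -> wtgt a = bwsrc (val c) ->
  val (val g).1.1 = bwcat a (val c) -> (val g).1.2 = (wlen a)%:Z ->
  (val g).2 = c ->
  early_edge i (val (val g).1.1) (wlen a) <->
  exists e, [/\ early i e, esrc e = wtgt a & step_cylinder a e g].
Proof.
move=> ea ac xE mE yE; split.
  rewrite xE -[wlen a]addn0 /early_edge bedge_cat_r.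
  case ce : bedge => [e|//] ee; have [c' [s1 s2 s3]] := bedge0_Some ce.
  exists e; split=> //; first by rewrite ac.
  exists c'; split.
  - by rewrite wtgt_ext.
  - by rewrite -s2.
  - by rewrite xE s3 bwcatA ac s1.
  - by rewrite mE wlen_cat PoszD addrK.
  - by rewrite yE s3 ac s1.
move=> [e [ee eE [c' [_ _ xE' _ _]]]].
rewrite xE'; apply: early_edge_cat_l; last by rewrite wlen_cat addn1.
by case/andP: ea => a1 a2; rewrite /early_word /= a1 all_cat a2 /= ee.
Qed.

(** The weight is 1 if the walk goes on beyond [n] and [i + 1 - n] if it stops there; how far it
    goes on does not matter. This makes the amplitude locally constant. *)
Lemma weight_congr i t t' n : (n <= t)%N -> (n <= t')%N ->
  (n < t)%N = (n < t')%N -> weight i t n = weight i t' n.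
Proof.
rewrite /weight => nt nt' tt'; rewrite tt'; case: ltnP => // le.
have -> : n = t' by apply/eqP; rewrite eqn_leq nt'.
suff -> : t = t' by [].
by move: nt nt' tt' le; lia.
Qed.

Lemma walk_amplitude_support i g : walk_amplitude R i (val g) != 0 ->
  exists2 a, early_path i a & shift_cylinder a g.
Proof.
case gE : (val g) => [[x m] y] /walk_amplitude_neq0[n [ex nd mE yE]].
have [a [c [pa ea an ac xE]]] := depth_split ex nd.
exists a; first by split=> //; rewrite an (leq_trans nd) // depth_le.
by apply/shift_cylinderP; exists c; rewrite gE /= mE yE -an (bshift_wlen ac xE).
Qed.

(** The shift cylinder containing [g] fixes the position [wlen a], and the step cylinders tell
    whether the walk stops there; by [weight_congr] this determines the amplitude. *)
Lemma walk_amplitude_congr i g h :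
  (forall a, early_path i a -> shift_cylinder a g <-> shift_cylinder a h) ->
  (forall a e, early_path i a -> early i e -> esrc e = wtgt a ->
    step_cylinder a e g <-> step_cylinder a e h) ->
  walk_amplitude R i (val g) != 0 ->
  walk_amplitude R i (val h) = walk_amplitude R i (val g).
Proof.
move=> ghS ghE g0; have [a pa ga] := walk_amplitude_support g0.
have ha : shift_cylinder a h by apply/ghS.
have [fa ea ai] := pa.
have ampE k : shift_cylinder a k -> (wlen a <= depth i (val k).1.1)%N /\
    walk_amplitude R i (val k) =
    Num.sqrt ((weight i (depth i (val k).1.1) (wlen a))%:R / i.+1%:R).
  move=> /shift_cylinderP[c [ac xE mE yE]].
  have ex : early i (bwsrc (val (val k).1.1)).
    by rewrite xE bwsrc_cat //; case/andP: ea.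
  have nd : (wlen a <= depth i (val k).1.1)%N by rewrite (depth_cat ea ai xE) leq_addr.
  split=> //; rewrite -walk_amplitudeE // (bshift_wlen ac xE) -yE -mE.
  by rewrite -!surjective_pairing.
have [gd ->] := ampE g ga; have [hd ->] := ampE h ha.
congr (Num.sqrt (_%:R / _)); apply: weight_congr => //.
rewrite !run_gt //; congr (_ && _).
have [c [ac xE mE yE]] := (shift_cylinderP a g).1 ga.
have [c' [ac' xE' mE' yE']] := (shift_cylinderP a h).1 ha.
apply/idP/idP.
  move=> /(early_edge_step ea ac' xE' mE' yE')[e [ee eE /(ghE _ _ pa ee eE) ge]].
  by apply/(early_edge_step ea ac xE mE yE); exists e.
move=> /(early_edge_step ea ac xE mE yE)[e [ee eE /(ghE _ _ pa ee eE) he]].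
by apply/(early_edge_step ea ac' xE' mE' yE'); exists e.
Qed.

Lemma walk_function_Cc i : Cc (@walk_function R E i).
Proof.
have fP := finite_early_path i.
split.
  (* The finitely many cylinders that determine the value of the function. *)
  pose D : set (word E * word E) :=
    [set (a, (wtgt a, [::])) | a in early_path i] `|`
    ([set (wcat p.1 (wtgt p.1, [:: p.2]), (wtgt p.1, [:: p.2])) | p in
      (early_path i `*` [set e | early i e]) `&` [set p | esrc p.2 = wtgt p.1]]).
  apply: (@continuous_finite_clopen _ _ _ D (fun p => arrow_cylinder p.1 p.2)).
  - rewrite finite_setU; split; apply: finite_image => //.
    by apply: finite_setIl; apply: finite_setX => //; exact: finite_early.
  - move=> _ [[a [pa _ _] <-]|[[a e] [[[pa _ _] _] /= eE] <-]] /=.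
      by split; [exact: arrow_cylinder_open|exact: arrow_cylinder_closed].
    have pe : fpath (wtgt a, [:: e]) by [].
    have pae : fpath (wcat a (wtgt a, [:: e])) by exact: fpath_cat.
    have t : wtgt (wcat a (wtgt a, [:: e])) = wtgt (wtgt a, [:: e]).
      by rewrite wtgt_ext.
    by split; [exact: arrow_cylinder_open|exact: arrow_cylinder_closed].
  - move=> g h gh; rewrite /walk_function; congr (_%:C).
    have ghS a : early_path i a -> shift_cylinder a g <-> shift_cylinder a h.
      by move=> pa; apply: (gh (a, (wtgt a, [::]))); left; exists a.
    have ghE a e : early_path i a -> early i e -> esrc e = wtgt a ->
        step_cylinder a e g <-> step_cylinder a e h.
      move=> pa ee eE.
      apply: (gh (wcat a (wtgt a, [:: e]), (wtgt a, [:: e]))); right.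
      by exists (a, e).
    (* [walk_amplitude_congr] needs a nonzero value at its first arrow, so it is applied to
       whichever of [g] and [h] has one. *)
    have [g0|g0] := eqVneq (walk_amplitude R i (val g)) 0; last first.
      by rewrite (walk_amplitude_congr ghS ghE g0).
    have [h0|h0] := eqVneq (walk_amplitude R i (val h)) 0; first by rewrite g0 h0.
    apply: walk_amplitude_congr h0.
      by move=> a pa; apply: iff_sym; exact: ghS.
    by move=> a e pa ee eE; apply: iff_sym; exact: ghE.
(* The support lies in a finite union of shift cylinders, which is compact and closed. *)
apply: (@subclosed_compact _ _ (\bigcup_(a in early_path i) shift_cylinder a)).
- exact: closed_closure.
- have [r rE] := (finite_seqP _).1 fP; rewrite rE bigcup_seq big_seq.
  elim/big_ind : _ => [|A B|a ar]; [exact: compact0|exact: compactU|].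
  have [pa _ _] : early_path i a by rewrite rE; exact: ar.
  exact: arrow_cylinder_compact.
- have cS : closed (\bigcup_(a in early_path i) shift_cylinder a).
    by apply: closed_bigcup => // a [pa _ _]; exact: (arrow_cylinder_closed pa).
  rewrite [X in _ `<=` X]((closure_id _).1 cS); apply: closureS => g /= fg.
  have /walk_amplitude_support[a pa ga] : walk_amplitude R i (val g) != 0.
    by apply: contra_neq fg; rewrite /walk_function => ->.
  by exists a.
Qed.

(** * Convergence of the convolutions on compact sets *)

Lemma early_word_eventually a : exists i0, forall i, (i0 <= i)%N -> early_word i a.
Proof.
case: a => v es; rewrite /early_word /early /=.
have [i0 i0P] : exists i0, forall i, (i0 <= i)%N -> all (early i) es.
  elim: es => [|e es [i0 IH]]; first by exists 0%N.
  exists (maxn (pickle e).+1 i0) => i; rewrite geq_max => /andP[ei /IH /= ->].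
  by rewrite andbT.
exists (maxn (pickle v).+1 i0) => i; rewrite geq_max => /andP[vi /i0P ei].
exact/andP.
Qed.

(** The bound of [walk_convolution_near1] depends only on [a] and [b], so it is uniform on an open
    cylinder around each arrow; compactness of [K] then yields a common [i0]. *)
Lemma walk_convolution_cvg (K : set (path_groupoid E)) (eps : R) :
  compact K -> 0 < eps ->
  exists i0, forall i, (i0 <= i)%N -> forall g, K g ->
  `|convolution (walk_function R i) (involution (walk_function R i)) g - 1|
    < eps%:C.
Proof.
move=> cK eps0.
pose P i (g : path_groupoid E) := `|convolution (walk_function R i)
  (involution (walk_function R i)) g - 1| < eps%:C.
have : \forall i \near \oo, K `<=` P i.
  apply: ((compact_near_coveringP _).1 cK) => g _.
  have [a [b [pa pb gab]]] := set_valP (g : path_arrow E).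
  have ab : wtgt a = wtgt b by case: gab => c [-> ->].
  have [ia iaP] := early_word_eventually a; have [ib ibP] := early_word_eventually b.
  pose k := maxn (wlen a) (wlen b).
  (* From [i0] on, [a] and [b] are early words of length at most [i], and [i + 1] exceeds
     [k / eps]. *)
  pose i0 := maxn (maxn ia ib) (maxn k (Num.bound (k%:R / eps))).
  exists (arrow_cylinder a b, [set i | (i0 <= i)%N]); first split=> /=.
  - exact: open_nbhs_nbhs (conj (arrow_cylinder_open pa pb ab) gab).
  - by exists i0.
  move=> [h i] /= [hab]; rewrite /i0 !geq_max => /andP[/andP[/iaP ea /ibP eb] /andP[ki bi]].
  rewrite -geq_max in ki.
  apply: le_lt_trans (walk_convolution_near1 R ea eb pa pb ki hab) _.
  rewrite ltcR ltr_pdivrMr ?ltr0n // mulrC -ltr_pdivrMr //.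
  apply: lt_le_trans (archi_boundP _) _; first by rewrite divr_ge0 // ltW.
  by rewrite ler_nat leqW.
by move=> [i0 _ i0P]; exists i0 => i /i0P KP g /KP.
Qed.

End CompactSupport.

Theorem theorem3 (R : realType) (E : digraph) :
  no_sinks E -> amenable R (path_groupoid E).
Proof.
move=> _; exists nat, (fun m n => m <= n)%N, (fun i => @walk_function R E i).
split.
- split=> [|//|i j k ij|i j]; [exact: inhabits 0%N|exact: leq_trans|].
  by exists (maxn i j); rewrite ?leq_maxl ?leq_maxr.
- exact: walk_function_Cc.
- by exists 1 => i u; exact: walk_fibre_norm2.
- by move=> K cK eps eps0; exact: walk_convolution_cvg.
Qed.
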